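(* Let $n,k\in\mathbb N$ and let $U=\{(x_i,n)\}_{i\in\{1,\dots,k\}}$ and $V=\{(y_i,1)\}_{i\in\{1,\dots,k\}}$ be an endpoint pair with $x_i\ge0$ for all $i$. Then for any $n$-tuple $f=(f_1,\dots,f_n)$ of continuous functions $f_i:[0,\infty)\to\mathbb R$, $$f[U\to V]=\mathcal Wf[U\to V].$$
   Context: Paths: for $x\le y$ and integers $m\le\ell$, a path from $(x,\ell)$ to $(y,m)$ is a nonincreasing cadlag function $\pi:[x,y]\to\mathbb Z$ with $\pi(x)\le\ell$ and $\pi(y)=m$ (its left limit at $x$ is by convention $\ell$). For $m\le i\le\ell-1$ its jump time $t_i\in[x,y]$ is the unique time with $\pi(s)\ge i+1$ for $s<t_i$ and $\pi(s)\le i$ for $s\ge t_i$; set $t_\ell=x$, $t_{m-1}=y$. The length of $\pi$ with respect to $f$ is $\int df\circ\pi=\sum_{i=m}^{\ell}[f_i(t_{i-1})-f_i(t_i)]$. For $U=\{(x_i,\ell_i)\}_{i=1}^k$ and $V=\{(y_i,m_i)\}_{i=1}^k$, $\mathcal Q(U,V)$ is the set of $k$-tuples $\pi=(\pi_1,\dots,\pi_k)$ where $\pi_i$ is a path from $(x_i,\ell_i)$ to $(y_i,m_i)$ and, for all $i\in\{1,\dots,k-1\}$, $\pi_i(t)<\pi_{i+1}(t)$ for all $t\in(x_i,y_i)\cap(x_{i+1},y_{i+1})$. $(U,V)$ is an endpoint pair if $x_i\le y_i$ and $\ell_i\ge m_i$ for all $i$, $x_i\le x_{i+1}$ and $y_i\le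 y_{i+1}$ for all $i\le k-1$, and $\mathcal Q(U,V)\neq\emptyset$. The last passage value is $f[U\to V]=\sup_{\pi\in\mathcal Q(U,V)}\sum_{i=1}^k\int df\circ\pi_i$. Melon map $\mathcal W$: for continuous $f_1,f_2:[0,\infty)\to\mathbb R$ let $G(f_1,f_2)(x,y)=\min_{s\in[x,y]}[f_1(s)-f_2(s)]$ and $$W(f_1,f_2)_1(t)=f_1(t)-f_2(0)-G(f_1,f_2)(0,t),\qquad W(f_1,f_2)_2(t)=f_2(t)-f_1(0)+G(f_1,f_2)(0,t).$$ For $i\in\{1,\dots,n-1\}$ let $\sigma_i(f)$ be $f$ with the pair $(f_i,f_{i+1})$ replaced by $(W(f_i,f_{i+1})_1,W(f_i,f_{i+1})_2)$. Let $(i_1,\dots,i_{\binom n2})$ be any sequence in $\{1,\dots,n-1\}$ such that $\tau_{i_1}\cdots\tau_{i_{\binom n2}}$ is the reverse permutation $n\,(n-1)\cdots1$, where $\tau_i=(i,i+1)$ are adjacent transpositions. Then $\mathcal Wf=\sigma_{i_1}\cdots\sigma_{i_{\binom n2}}(f)$; this is known to be independent of the choice of such a sequence. *)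

(* Defs.v *)
From HB Require Import structures.
From mathcomp Require Import all_boot all_order all_algebra all_fingroup.
From mathcomp Require Import all_classical all_reals all_analysis.
Import Order.TTheory GRing.Theory Num.Theory.
Import numFieldNormedType.Exports.

Set Implicit Arguments.
Unset Strict Implicit.
Unset Printing Implicit Defensive.

Local Open Scope classical_set_scope.
Local Open Scope ring_scope.

(* Lines are labelled by integers, so a collection of functions (f_i) is a map
   int -> R -> R; a tuple (f_1, ..., f_n) only uses the labels 1, ..., n.
   An endpoint is a pair (time, line).                                        *)

Section Paths.
Context {R : realType}.

(* A path is a map on all of R of which only the values on [p.1, q.1] matter.
   As int is discrete, one-sided limits are eventual equalities.              *)
Definition is_path (p q : R * int) (pi : R -> int) : Prop :=
  [/\ {in `[p.1, q.1] &, forall s t : R, s <= t -> pi t <= pi s},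
      (forall s, p.1 <= s < q.1 -> \forall u \near s^'+, pi u = pi s),
      (forall s, p.1 < s <= q.1 ->
        exists l : int, \forall u \near s^'-, pi u = l),
      pi p.1 <= p.2 &
      pi q.1 = q.2].

Definition is_jump_time (x y : R) (pi : R -> int) (i : int) (t : R) : Prop :=
  [/\ x <= t <= y,
      (forall s, x <= s < t -> i + 1 <= pi s) &
      (forall s, t <= s <= y -> pi s <= i)].

(* The value on p.2 comes first: at p.2 the jump time is p.1 by convention,
   and at q.2 - 1 it is q.1. In between, the jump time of a path exists and is
   unique, so that the default value of xget is never used.                   *)
Definition jump_time (p q : R * int) (pi : R -> int) (i : int) : R :=
  if i == p.2 then p.1
  else if i == q.2 - 1 then q.1
  else xget p.1 [set t | is_jump_time p.1 q.1 pi i t].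

Definition path_length (f : int -> R -> R) (p q : R * int) (pi : R -> int)
    : R :=
  \sum_(j < `|p.2 - q.2|%N.+1)
    (let i := q.2 + j%:Z in
     f i (jump_time p q pi (i - 1)) - f i (jump_time p q pi i)).

Definition disjoint_paths (k : nat) (U V : 'I_k -> R * int)
    : set ('I_k -> R -> int) :=
  [set pi | (forall i, is_path (U i) (V i) (pi i)) /\
    (forall i j : 'I_k, j = i.+1 :> nat ->
      forall t, (U i).1 < t < (V i).1 -> (U j).1 < t < (V j).1 ->
        pi i t < pi j t)].

Definition endpoint_pair (k : nat) (U V : 'I_k -> R * int) : Prop :=
  [/\ (forall i, (U i).1 <= (V i).1),
      (forall i, (V i).2 <= (U i).2),
      (forall i j : 'I_k, j = i.+1 :> nat ->
        (U i).1 <= (U j).1 /\ (V i).1 <= (V j).1) &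
      disjoint_paths U V !=set0].

Definition last_passage (k : nat) (f : int -> R -> R) (U V : 'I_k -> R * int)
    : \bar R :=
  ereal_sup [set (\sum_(i < k) path_length f (U i) (V i) (pi i))%:E
            | pi in disjoint_paths U V].

End Paths.

Section Melon.
Context {R : realType}.

(* For continuous functions and x <= y this infimum is attained. *)
Definition gap (f1 f2 : R -> R) (x y : R) : R :=
  inf [set f1 s - f2 s | s in `[x, y]].

Definition W1 (f1 f2 : R -> R) (t : R) : R := f1 t - f2 0 - gap f1 f2 0 t.
Definition W2 (f1 f2 : R -> R) (t : R) : R := f2 t - f1 0 + gap f1 f2 0 t.

Definition sigma (i : int) (f : int -> R -> R) : int -> R -> R :=
  fun j => if j == i then W1 (f i) (f (i + 1))
           else if j == i + 1 then W2 (f i) (f (i + 1))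
           else f j.

(* The ordinal i : 'I_n stands for the label i + 1 in {1, ..., n}. In a word,
   a letter i < n - 1 stands for the transposition of the labels i + 1 and
   i + 2; ordS is the cyclic successor, the plain one for these letters. The
   order in which the product is taken is immaterial: reversing a word inverts
   the product, and the reverse permutation is an involution.                 *)
Definition reverse_word (n : nat) (w : seq 'I_n) : Prop :=
  [/\ all (fun i : 'I_n => i.+1 < n)%N w,
      size w = 'C(n, 2) &
      (\prod_(i <- w) tperm i (ordS i) = perm (@rev_ord_inj n))%g].

(* The melon map computed along w: the last letter of w acts first. *)
Definition melon (n : nat) (w : seq 'I_n) (f : int -> R -> R)
    : int -> R -> R :=
  foldr (fun (i : 'I_n) g => sigma (i.+1)%:Z g) f w.

End Melon.

(* Main.v *)
(* Each map sigma_m separately preserves the last passage value.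
   A tuple of disjoint paths is determined by the jump times t_(i, l)
   of path i from line l + 1 to line l, which form a Gelfand-Tsetlin type array:
   t_(i, l + 1) <= t_(i, l) <= t_(i + 1, l + 1). With all columns but the m-th
   fixed, put u_i = t_(i, m + 1) and v_i = t_(i, m - 1); then t_(i, m) ranges
   independently over [a_i, b_i], where a_i = max(u_i, v_(i - 1)) and
   b_i = min(v_i, u_(i + 1)), and the best contribution of column m is
   sum_i f_m(v_i) - f_(m + 1)(u_i) - G(a_i, b_i). Under the melon map, G(a, b)
   changes by - M(a) - M(b) + c with M(t) = G(0, t) (Pitman's identity), while
   f_m(v_i) and f_(m + 1)(u_i) change by - M(v_i) and + M(u_i), up to constants.
   These changes cancel, because the a_i and b_i together are a rearrangement of
   the u_i and v_i. *)
Require Import Defs.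
From HB Require Import structures.
From mathcomp Require Import all_boot all_order all_algebra all_fingroup.
From mathcomp Require Import all_classical all_reals all_analysis.
From mathcomp Require Import ring lra zify.
Import Order.TTheory GRing.Theory Num.Theory.
Import numFieldNormedType.Exports.

Local Open Scope classical_set_scope.
Local Open Scope ring_scope.

Set Implicit Arguments.
Unset Strict Implicit.

(** * Minima of differences and continuity of the melon of a pair *)

Lemma within_continuousB {R : realType} (A : set R) (f g : R -> R) :
  {within A, continuous f} -> {within A, continuous g} ->
  {within A, continuous (fun s => f s - g s)}.
Proof.
by move=> cf cg x; apply: continuousB; [exact: cf|exact: cg].
Qed.

Lemma within_continuousD {R : realType} (A : set R) (f g : R -> R) :
  {within A, continuous f} -> {within A, continuous g} ->
  {within A, continuous (fun s => f s + g s)}.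
Proof.
by move=> cf cg x; apply: continuousD; [exact: cf|exact: cg].
Qed.

Section Gap.
Context {R : realType} (g1 g2 : R -> R)
  (cg1 : {within `[0, +oo[, continuous g1})
  (cg2 : {within `[0, +oo[, continuous g2}).

Lemma gap_attained a b : 0 <= a -> a <= b ->
  (exists2 s, a <= s <= b & gap g1 g2 a b = g1 s - g2 s) /\
  (forall s, a <= s <= b -> gap g1 g2 a b <= g1 s - g2 s).
Proof.
move=> a0 ab.
have [] := @EVT_min R (fun s => g1 s - g2 s) a b ab.
  apply: (continuous_subspaceW _ (within_continuousB cg1 cg2)).
  by move=> s /=; rewrite !in_itv /= andbT => /andP[/(le_trans a0)].
move=> c; rewrite in_itv /= => cab cmin.
have lb : lbound [set g1 s - g2 s | s in `[a, b]] (g1 c - g2 c).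
  by move=> _ [s sab <-]; exact: cmin.
have E : gap g1 g2 a b = g1 c - g2 c.
  apply/eqP; rewrite eq_le; apply/andP; split.
    apply: ge_inf; first by exists (g1 c - g2 c).
    by exists c => //=.
  apply: lb_le_inf => //; exists (g1 c - g2 c); exists c => //=.
split; first by exists c.
by move=> s sab; rewrite E; apply: cmin; rewrite in_itv.
Qed.

Lemma gap_le s a b : 0 <= a -> a <= s <= b -> gap g1 g2 a b <= g1 s - g2 s.
Proof.
move=> a0 /andP[as_ sb].
have [_] := gap_attained a0 (le_trans as_ sb).
by apply; rewrite as_ sb.
Qed.

Lemma gap_subitv a b a' b' : 0 <= a -> a <= a' -> a' <= b' -> b' <= b ->
  gap g1 g2 a b <= gap g1 g2 a' b'.
Proof.
move=> a0 aa' ab' bb'.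
have [[s /andP[as_ sb] ->] _] := gap_attained (le_trans a0 aa') ab'.
by apply: gap_le => //; rewrite (le_trans aa' as_) (le_trans sb bb').
Qed.

Lemma gap_cat s t : 0 <= s -> s <= t ->
  gap g1 g2 0 t = Num.min (gap g1 g2 0 s) (gap g1 g2 s t).
Proof.
move=> s0 st; apply/eqP; rewrite eq_le; apply/andP; split.
  by rewrite le_min !gap_subitv.
have [[r /andP[r0 rt] ->] _] := gap_attained (lexx 0) (le_trans s0 st).
rewrite ge_min; case: (leP r s) => rs.
  by rewrite gap_le ?r0.
by rewrite [X in _ || X]gap_le ?orbT // (ltW rs).
Qed.

Lemma within_continuous_gap : {within `[0, +oo[, continuous (gap g1 g2 0)}.
Proof.
apply/subspace_continuousP => t /=; rewrite in_itv /= andbT => t0.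
have /subspace_continuousP/(_ t) := (within_continuousB cg1 cg2).
rewrite /= in_itv /= andbT => /(_ t0) /cvgrPdist_lt Dt.
apply/cvgrPdist_le => e e0; have e2 : 0 < e / 2 by lra.
pose D := fun s => g1 s - g2 s.
have := Dt _ e2.
rewrite !near_withinE => /nbhs_ballP[d /= d0 Dd].
apply/nbhs_ballP; exists d => //= s bs; rewrite in_itv /= andbT => s0.
(* Both orders of [s] and [t] reduce to one ordered pair. After [u] the running minimum drops only
   if [D] falls below its value at [u], which is at most [D u]; so the drop is at most the
   oscillation of [D] near [t]. *)
suff H u v : 0 <= u -> u <= v ->
    (forall r, u <= r <= v -> 0 <= r /\ ball t d r) ->
    `|gap g1 g2 0 u - gap g1 g2 0 v| <= e.
  have bt : ball t d t by exact: ballxx.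
  have [st|/ltW ts] := leP s t.
    rewrite distrC; apply: H => // r /andP[sr rt]; split; first lra.
    by move: bs; rewrite /ball /= /ball /= !ger0_norm; lra.
  apply: H => // r /andP[sr rt]; split; first lra.
  by move: bs; rewrite /ball /= /ball /= !ler0_norm; lra.
move=> u0 uv uvP.
have DP r : u <= r <= v -> `|D t - D r| < e / 2.
  by move=> /uvP[r0 br]; apply: Dd => //; rewrite in_itv /= r0.
have Mu : gap g1 g2 0 u <= D u by apply: gap_le => //; rewrite u0 lexx.
rewrite (gap_cat u0 uv).
have [[r ruv ->] _] := gap_attained u0 uv; rewrite -/(D r).
have := DP u; rewrite lexx uv => /(_ isT).
have := DP r ruv; rewrite !ltr_norml => ? ?.
by case: (leP (gap g1 g2 0 u) (D r)) => ?; rewrite ler_norml; lra.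
Qed.

Lemma within_continuous_W1 : {within `[0, +oo[, continuous (W1 g1 g2)}.
Proof.
apply: within_continuousB within_continuous_gap.
by apply: within_continuousB cg1 _ => x; exact: cst_continuous.
Qed.

Lemma within_continuous_W2 : {within `[0, +oo[, continuous (W2 g1 g2)}.
Proof.
apply: within_continuousD within_continuous_gap.
by apply: within_continuousB cg2 _ => x; exact: cst_continuous.
Qed.

End Gap.

(* Pitman's identity: [D - 2 M], with [M] the running minimum of [D], has
   minimum [G(a, b) - M a - M b] over [a, b]. *)
Lemma gap_melon {R : realType} (g1 g2 : R -> R) (a b : R) :
  {within `[0, +oo[, continuous g1} -> {within `[0, +oo[, continuous g2} ->
  0 <= a -> a <= b ->
  gap (W1 g1 g2) (W2 g1 g2) a b =
  gap g1 g2 a b - gap g1 g2 0 a - gap g1 g2 0 b + (g1 0 - g2 0).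
Proof.
move=> c1 c2 a0 ab.
have cW1 := within_continuous_W1 c1 c2.
have cW2 := within_continuous_W2 c1 c2.
pose D s := g1 s - g2 s; pose M s := gap g1 g2 0 s.
have WE s : W1 g1 g2 s - W2 g1 g2 s = D s - M s *+ 2 + (g1 0 - g2 0).
  by rewrite /W1 /W2 /D /M mulr2n; ring.
have b0 := le_trans a0 ab.
have MD s : 0 <= s -> M s <= D s by move=> s0; apply: gap_le; rewrite ?s0 ?lexx.
have Mmono s t : 0 <= s -> s <= t -> M t <= M s.
  by move=> s0 st; exact: gap_subitv.
have Mb : M b = Num.min (M a) (gap g1 g2 a b) by exact: gap_cat.
(* Lower bound, at any [s] in the interval: if [M a <= G(a, b)] then [M] is constant there;
   otherwise [M b = G(a, b)], and [D - 2 M >= - M s >= - M a]. *)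
apply/eqP; rewrite eq_le -/(M a) -/(M b); apply/andP; split; last first.
  have [[s /andP[as_ sb] ->] _] := gap_attained cW1 cW2 a0 ab.
  rewrite WE lerD2r.
  have s0 := le_trans a0 as_.
  have := MD _ s0; have := Mmono _ _ a0 as_; have := Mmono _ _ s0 sb.
  have : gap g1 g2 a b <= D s by apply: gap_le; rewrite ?as_.
  by rewrite Mb mulr2n; case: (leP (M a) (gap g1 g2 a b)) => ?; lra.
have gW s : a <= s <= b ->
    gap (W1 g1 g2) (W2 g1 g2) a b <= D s - M s *+ 2 + (g1 0 - g2 0).
  by move=> sab; rewrite -WE; exact: gap_le.
(* Here [M] is constant on the interval, so a minimiser of [D] attains the bound. *)
have [Ma|Ma] := leP (M a) (gap g1 g2 a b).
  have [[s /andP[as_ sb] sE] _] := gap_attained c1 c2 a0 ab.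
  apply: le_trans (gW s _) _; first by rewrite as_.
  rewrite lerD2r /D -sE.
  have := Mmono _ _ (le_trans a0 as_) sb; move: Mb; rewrite (min_idPl Ma) => ->.
  by have := Mmono _ _ a0 as_; rewrite mulr2n; lra.
rewrite Mb (min_idPr (ltW Ma)).
(* Now [M] descends continuously from [M a] to [G(a, b)]. At a point [r] where [D] realises an
   intermediate value [v] of [M], one has [D r = M r = v], hence [D - 2 M = - v]; moreover [r >= a]
   because [M r < M a]. Letting [v] tend to [M a] gives the bound. *)
have key v : gap g1 g2 a b < v < M a ->
    gap (W1 g1 g2) (W2 g1 g2) a b <= - v + (g1 0 - g2 0).
  move=> /andP[mv va].
  have [] := @IVT R M a b v ab.
  - apply: (continuous_subspaceW _ (within_continuous_gap c1 c2)).
    by move=> s /=; rewrite !in_itv /= andbT => /andP[/(le_trans a0)].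
  - rewrite Mb (min_idPr (ltW Ma)) (min_idPr (ltW Ma)) (max_idPl (ltW Ma)).
    by lra.
  move=> c; rewrite in_itv /= => /andP[ac cb] Mc.
  have c0 := le_trans a0 ac.
  have [[r /andP[r0 rc] rE] _] := gap_attained c1 c2 (lexx 0) c0.
  have Dr : D r = v by rewrite -Mc /M rE.
  have Mr : M r = v.
    by apply/eqP; rewrite eq_le -{1}Dr MD //= -Mc; exact: Mmono.
  have ar : a <= r.
    by rewrite leNgt; apply/negP => /ltW /(Mmono _ _ r0); rewrite Mr leNgt va.
  apply: le_trans (gW r _) _; first by rewrite ar (le_trans rc cb).
  by rewrite Dr Mr mulr2n; lra.
set w := gap (W1 _ _) _ _ _ in key *.
have [//|wM] := leP w (gap g1 g2 a b - M a - gap g1 g2 a b + (g1 0 - g2 0)).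
(* If [w] exceeded the bound, any [v] strictly between [lo] and [M a] would contradict [key]; the
   midpoint is taken. *)
pose lo := Num.max (gap g1 g2 a b) (g1 0 - g2 0 - w).
have lolt : lo < M a by rewrite /lo gt_max Ma /=; lra.
have := key ((lo + M a) / 2).
have : gap g1 g2 a b <= lo by rewrite /lo le_max lexx.
have : g1 0 - g2 0 - w <= lo by rewrite /lo le_max lexx orbT.
move=> ? ?; have -> : gap g1 g2 a b < (lo + M a) / 2 < M a by lra.
by move=> /(_ isT); lra.
Qed.

(** * Interlacing arrays and the optimisation of a single column *)

Section Interlacing.
Context {R : realType}.
Implicit Types (n k m : nat) (f h : int -> R -> R) (T : nat -> nat -> R)
  (u v : nat -> R).

(* [T i l] is the time at which the path [i] leaves line [l + 1] for line [l]:
   column [0] consists of the end times and column [n] of the start times.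
   Nonintersection amounts to the last inequality. *)
Definition interlacing n k T : Prop :=
  (forall i l, (i < k)%N -> (l < n)%N -> T i l.+1 <= T i l) /\
  (forall i l, (i.+1 < k)%N -> (l < n)%N -> T i l <= T i.+1 l.+1).

Lemma interlacing_le n k T i l l' : interlacing n k T -> (i < k)%N ->
  (l <= l')%N -> (l' <= n)%N -> T i l' <= T i l.
Proof.
move=> [Tl _] ik /subnKC <-; elim: (l' - l)%N => [|d IH]; rewrite ?addn0 //.
rewrite addnS => ldn; exact: le_trans (Tl _ _ ik ldn) (IH (ltnW ldn)).
Qed.

Definition array_length n k f T : R :=
  \sum_(i < k) \sum_(l < n) (f l.+1%:Z (T i l) - f l.+1%:Z (T i l.+1)).

(* The range of an entry of an interlacing array, in terms of the next column
   [u] and of the previous column [v]. *)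
Definition slot_min u v (i : nat) : R :=
  if i is i'.+1 then Num.max (u i) (v i') else u i.

Definition slot_max k u v (i : nat) : R :=
  if (i.+1 < k)%N then Num.min (v i) (u i.+1) else v i.

Definition best_column k (g1 g2 : R -> R) u v : R :=
  \sum_(i < k) (g1 (v i) - g2 (u i) -
                gap g1 g2 (slot_min u v i) (slot_max k u v i)).

(** The lower end of slot [i.+1] and the upper end of slot [i] are the maximum and the minimum of
    the same two numbers [u i.+1] and [v i]. The unpaired ends are [u 0] and the last [v]. *)
Lemma sum_slot k u v (M : R -> R) :
  \sum_(i < k) (M (slot_min u v i) + M (slot_max k u v i)) =
  \sum_(i < k) (M (u i) + M (v i)).
Proof.
case: k => [|k]; first by rewrite !big_ord0.
rewrite !big_split /= big_ord_recl [X in _ + X]big_ord_recr /=.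
rewrite [X in _ = X + _]big_ord_recl [X in _ = _ + X]big_ord_recr /=.
have -> : slot_max k.+1 u v k = v k by rewrite /slot_max ltnn.
suff E : \sum_(i < k) M (Num.max (u i.+1) (v i)) +
         \sum_(i < k) M (slot_max k.+1 u v i) =
         \sum_(i < k) M (u i.+1) + \sum_(i < k) M (v i).
  rewrite -addrA [X in _ + X = _]addrA E; rewrite -!addrA; congr (_ + _).
rewrite -!big_split /=; apply: eq_bigr => i _.
rewrite /slot_max ltnS ltn_ord.
by case: (leP (u i.+1) (v i)) => _; rewrite // addrC.
Qed.

(* The corrections in [gap_melon] cancel by [sum_slot]. *)
Lemma best_column_melon k (g1 g2 : R -> R) u v :
  {within `[0, +oo[, continuous g1} -> {within `[0, +oo[, continuous g2} ->
  (forall i, (i < k)%N -> 0 <= u i) ->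
  (forall i, (i < k)%N -> slot_min u v i <= slot_max k u v i) ->
  best_column k (W1 g1 g2) (W2 g1 g2) u v = best_column k g1 g2 u v.
Proof.
move=> c1 c2 u0 uv; rewrite /best_column.
pose M := gap g1 g2 0.
have lo0 i : (i < k)%N -> 0 <= slot_min u v i.
  case: i => [|i] ik /=; first exact: u0.
  by rewrite le_max u0.
transitivity (\sum_(i < k) (g1 (v i) - g2 (u i) -
    gap g1 g2 (slot_min u v i) (slot_max k u v i) +
    (M (slot_min u v i) + M (slot_max k u v i) - (M (u i) + M (v i))))).
  apply: eq_bigr => i _; rewrite (gap_melon c1 c2) ?lo0 ?uv //.
  by rewrite /W1 /W2 /M; ring.
by rewrite big_split /= [X in _ + X]sumrB sum_slot subrr addr0.
Qed.

Lemma slot_mem n k T m i : interlacing n k T -> (m.+1 < n)%N -> (i < k)%N ->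
  slot_min (T^~ m.+2) (T^~ m) i <= T i m.+1 <= slot_max k (T^~ m.+2) (T^~ m) i.
Proof.
move=> [Tl Ti] mn ik; have mn' := ltnW mn; apply/andP; split.
  by case: i ik => [|i] ik /=; rewrite ?ge_max ?Tl ?Ti.
by rewrite /slot_max; case: ifP => ik'; rewrite ?le_min ?Tl ?Ti.
Qed.

Definition set_column T m (s : nat -> R) : nat -> nat -> R :=
  fun i l => if l == m then s i else T i l.

(** An inner column is constrained only by its two neighbours, and these constraints are exactly the
    slot bounds; hence its entries can be chosen independently. *)
Lemma interlacing_set_column n k T m s : interlacing n k T -> (m.+1 < n)%N ->
  (forall i, (i < k)%N -> slot_min (T^~ m.+2) (T^~ m) i <= s i
                       <= slot_max k (T^~ m.+2) (T^~ m) i) ->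
  interlacing n k (set_column T m.+1 s).
Proof.
move=> [Tl Ti] mn sP; rewrite /set_column; split=> i l ik ln; rewrite eqSS.
  case: (eqVneq l m.+1) => [->|lm]; first rewrite gtn_eqF //.
    have := sP i ik; case/andP => + _.
    by case: i ik => [|i] ik //=; rewrite ge_max => /andP[].
  case: (eqVneq l m) => [->|lm']; last exact: Tl.
  have := sP i ik; case/andP => _.
  by rewrite /slot_max; case: ifP => _ //; rewrite le_min => /andP[].
case: (eqVneq l m.+1) => [->|lm]; first rewrite gtn_eqF //.
  have := sP i (ltnW ik); case/andP => _.
  by rewrite /slot_max ik le_min => /andP[].
case: (eqVneq l m) => [->|lm']; last exact: Ti.
by have := sP i.+1 ik; case/andP => + _; rewrite /= ge_max => /andP[].
Qed.

Definition column_length k (g1 g2 : R -> R) u v (s : nat -> R) : R :=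
  \sum_(i < k) (g1 (v i) - g2 (u i) - (g1 (s i) - g2 (s i))).

(** Column [m.+1] enters only the summands [l = m] and [l = m.+1]. Regrouping their four values
    isolates the difference of the two functions at the free entry, with a minus sign, so that an
    optimal entry minimises this difference. *)
Lemma array_length_column n k f T m : (m.+1 < n)%N ->
  array_length n k f T =
  \sum_(i < k) \sum_(l < n | (l != m :> nat) && (l != m.+1 :> nat))
    (f l.+1%:Z (T i l) - f l.+1%:Z (T i l.+1)) +
  column_length k (f m.+1%:Z) (f m.+2%:Z) (T^~ m.+2) (T^~ m) (T^~ m.+1).
Proof.
move=> mn; rewrite -big_split /=; apply: eq_bigr => i _.
rewrite (bigD1 (Ordinal (ltnW mn))) // (bigD1 (Ordinal mn)) /=; last first.
  by rewrite -val_eqE /= gtn_eqF.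
set S := (X in _ + (_ + X) = _).
set S' := (X in _ = X + _); have -> : S' = S.
  by apply: eq_bigl => l; rewrite -!val_eqE.
by ring.
Qed.

Lemma column_length_le n k f T m : interlacing n k T -> (m.+1 < n)%N ->
  {within `[0, +oo[, continuous (f m.+1%:Z)} ->
  {within `[0, +oo[, continuous (f m.+2%:Z)} ->
  (forall i, (i < k)%N -> 0 <= T i m.+2) ->
  column_length k (f m.+1%:Z) (f m.+2%:Z) (T^~ m.+2) (T^~ m) (T^~ m.+1) <=
  best_column k (f m.+1%:Z) (f m.+2%:Z) (T^~ m.+2) (T^~ m).
Proof.
move=> Tint mn c1 c2 T0; apply: ler_sum => i _; rewrite lerD2l lerN2.
apply: gap_le => //; last exact: slot_mem Tint mn (ltn_ord i).
by case: i => [[|i] ik] /=; rewrite ?le_max T0.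
Qed.

Lemma best_column_attained k (g1 g2 : R -> R) u v :
  {within `[0, +oo[, continuous g1} -> {within `[0, +oo[, continuous g2} ->
  (forall i, (i < k)%N -> 0 <= u i) ->
  (forall i, (i < k)%N -> slot_min u v i <= slot_max k u v i) ->
  exists2 s : nat -> R,
    forall i, (i < k)%N -> slot_min u v i <= s i <= slot_max k u v i &
    column_length k g1 g2 u v s = best_column k g1 g2 u v.
Proof.
move=> c1 c2 u0 uv.
have /choice[s sP] : forall i, exists s, (i < k)%N ->
    slot_min u v i <= s <= slot_max k u v i /\
    gap g1 g2 (slot_min u v i) (slot_max k u v i) = g1 s - g2 s.
  move=> i; have [ik|_] := ltnP i k; last by exists 0.
  have lo0 : 0 <= slot_min u v i.
    by case: i ik => [|i] ik /=; rewrite ?le_max u0.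
  by have [[s sP sE] _] := gap_attained c1 c2 lo0 (uv i ik); exists s.
exists s => [i /sP[] //|].
by apply: eq_bigr => i _; rewrite (sP i (ltn_ord i)).2.
Qed.

(** Column [m.+1] is replaced by an optimal one for [h]. The hypotheses treat [f] and [h] alike, so
    that the lemma applies in both directions between a tuple and its image under [sigma]. *)
Lemma array_length_improve n k f h T m : interlacing n k T -> (m.+1 < n)%N ->
  (forall i, (i < k)%N -> 0 <= T i n) ->
  (forall i : int, 1 <= i <= n%:Z -> {within `[0, +oo[, continuous (f i)}) ->
  (forall i : int, 1 <= i <= n%:Z -> {within `[0, +oo[, continuous (h i)}) ->
  (forall i : int, i != m.+1%:Z -> i != m.+2%:Z -> h i = f i) ->
  (forall u v, (forall i, (i < k)%N -> 0 <= u i) ->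
    (forall i, (i < k)%N -> slot_min u v i <= slot_max k u v i) ->
    best_column k (f m.+1%:Z) (f m.+2%:Z) u v =
    best_column k (h m.+1%:Z) (h m.+2%:Z) u v) ->
  exists T', [/\ interlacing n k T', forall i, T' i n = T i n,
    forall i, T' i 0%N = T i 0%N &
    array_length n k f T <= array_length n k h T'].
Proof.
move=> Tint mn T0 cf ch hf best.
have T0' l i : (i < k)%N -> (l <= n)%N -> 0 <= T i l.
  move=> ik ln; apply: le_trans (T0 i ik) _.
  exact: (interlacing_le Tint ik ln (leqnn n)).
have m1 : (1 <= m.+1%:Z <= n%:Z) by lia.
have m2 : (1 <= m.+2%:Z <= n%:Z) by lia.
have u0 i : (i < k)%N -> 0 <= T i m.+2 by move=> ik; exact: T0'.
have uv i : (i < k)%N ->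
    slot_min (T^~ m.+2) (T^~ m) i <= slot_max k (T^~ m.+2) (T^~ m) i.
  by move=> ik; have /andP[] := slot_mem Tint mn ik; exact: le_trans.
have [s sP sE] := best_column_attained (ch _ m1) (ch _ m2) u0 uv.
exists (set_column T m.+1 s); split.
- exact: interlacing_set_column.
- by move=> i; rewrite /set_column gtn_eqF.
- by move=> i; rewrite /set_column.
rewrite !(array_length_column _ _ _ mn); apply: lerD.
  rewrite le_eqVlt; apply/orP; left; apply/eqP.
  apply: eq_bigr => i _; apply: eq_bigr => l /andP[l1 l2].
  rewrite /set_column (negPf l2) eqSS (negPf l1) hf //; lia.
apply: le_trans (column_length_le Tint mn (cf _ m1) (cf _ m2) u0) _.
rewrite best // -sE /column_length le_eqVlt; apply/orP; left; apply/eqP.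
apply: eq_bigr => i _; rewrite /set_column eqxx.
by rewrite ltn_eqF // gtn_eqF.
Qed.

End Interlacing.

(** * Jump times of paths, and step paths with prescribed jump times *)

Section PathsOfArrays.
Context {R : realType}.
Implicit Types (n k l : nat) (x y s t : R) (pi : R -> int) (tau : nat -> R).

(* The conventions at [l = n] and [l = 0] satisfy the defining property of a
   jump time only on the open interval, whence the restriction on [s]. *)
Lemma jump_timeP n x y pi l : (0 < n)%N -> x <= y ->
  is_path (x, n%:Z) (y, 1%:Z) pi -> (l <= n)%N ->
  x <= jump_time (x, n%:Z) (y, 1%:Z) pi l%:Z <= y /\
  forall s, x < s < y ->
    (pi s <= l%:Z) = (jump_time (x, n%:Z) (y, 1%:Z) pi l%:Z <= s).
Proof.
move=> n0 xy [/= mono rc _ pix piy] ln; rewrite /jump_time /=.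
have inI s : x <= s <= y -> s \in `[x, y] by rewrite in_itv.
case: eqP => [[->]|nl].
  rewrite lexx xy; split=> // s /andP[xs sy]; rewrite (ltW xs).
  by apply: le_trans pix; apply: mono;
    rewrite ?inI ?lexx ?xy ?(ltW xs) ?(ltW sy).
case: eqP => [l0|nl0].
  rewrite lexx xy; split=> // s /andP[xs sy]; rewrite [RHS]leNgt sy /=.
  have : pi y <= pi s.
    by apply: mono; rewrite ?inI ?lexx ?xy ?(ltW xs) ?(ltW sy).
  by rewrite piy; lia.
pose A := [set s | x <= s <= y /\ pi s <= l%:Z].
have Ay : A y by split; [rewrite xy lexx|rewrite piy; lia].
have lbA : lbound A x by move=> s [/andP[]].
have hlbA : has_lbound A by exists x.
have xA : x <= inf A by apply: lb_le_inf => //; exists y.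
have Ay' : inf A <= y by apply: ge_inf.
(* By right continuity [pi] is constant just after the infimum, where points of [A] accumulate;
   hence the infimum belongs to [A] and is the jump time. *)
have piA : pi (inf A) <= l%:Z.
  move: (Ay'); rewrite le_eqVlt => /orP[/eqP->|Aly]; first by case: Ay.
  have /rc : x <= inf A < y by rewrite xA.
  case/nbhs_ballP => e /= e0 He.
  have [|s [/andP[xs sy] sl] sA] := @inf_adherent _ A e e0.
    by split=> //; exists y.
  have : inf A <= s by apply: ge_inf => //; split=> //; rewrite xs.
  rewrite le_eqVlt => /orP[/eqP -> //|As].
  rewrite -(He s) // /ball /= ltr0_norm; lra.
have HJ : is_jump_time x y pi l%:Z (inf A).
  split; first by rewrite xA.
    move=> s /andP[xs sA]; rewrite leNgt; apply/negP => H.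
    have : inf A <= s; last by lra.
    by apply: ge_inf => //; split; [rewrite xs (le_trans (ltW sA))|lia].
  move=> s /andP[As sy]; apply: le_trans piA; apply: mono => //.
    by rewrite inI // xA.
  by rewrite inI // sy (le_trans xA).
set J := xget _ _; have [xJ J1 J2] : is_jump_time x y pi l%:Z J.
  by rewrite /J; case: xgetP => [//|/(_ (inf A))].
split=> // s /andP[xs sy]; have [Js|sJ] := leP J s.
  by rewrite J2 // Js ltW.
by have := J1 s; rewrite (ltW xs) sJ => /(_ isT); lia.
Qed.

Lemma jump_time_eq (p q : R * int) pi (i : int) t : i != p.2 -> i != q.2 - 1 ->
  is_jump_time p.1 q.1 pi i t -> jump_time p q pi i = t.
Proof.
move=> /negPf ip /negPf iq tJ; rewrite /jump_time ip iq.
have uniq u v : is_jump_time p.1 q.1 pi i u -> is_jump_time p.1 q.1 pi i v ->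
    u <= v.
  move=> [/andP[pu uq] u1 u2] [/andP[pv vq] v1 v2]; rewrite leNgt.
  apply/negP => vu; have := u1 v; have := v2 v.
  by rewrite pv vu lexx vq => /(_ isT) ? /(_ isT); lia.
set J := xget _ _; have JJ : is_jump_time p.1 q.1 pi i J.
  by rewrite /J; case: xgetP => [//|/(_ t)].
by apply/eqP; rewrite eq_le !uniq.
Qed.

(** The path leaves line [j + 1] for line [j] at time [tau j], so its line is one plus the number of
    jumps still to come. The strict inequality makes it right continuous. *)
Definition step_path n tau s : int :=
  (\sum_(1 <= j < n) (s < tau j)%R).+1%:Z.

(** By monotonicity the jumps still to come form an initial segment of the indices, so fewer than
    [l] remain exactly when jump [l] has occurred. *)
Lemma step_path_le n tau l s :
  (forall j j', (j <= j' <= n)%N -> tau j' <= tau j) ->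
  (0 < l < n)%N -> (step_path n tau s <= l%:Z) = (tau l <= s).
Proof.
move=> mono /andP[l0 ln]; rewrite /step_path lez_nat.
rewrite (big_cat_nat (n := l.+1)) //=.
have [ls|sl] := leP (tau l) s.
  rewrite [X in (_ + X)%N]big_nat_cond [X in (_ + X)%N]big1 ?addn0; last first.
    move=> j /andP[/andP[lj jn] _]; rewrite ltNge (le_trans _ ls) //.
    by apply: mono; rewrite (ltnW lj) (ltnW jn).
  rewrite big_nat_recr //= (ltNge s (tau l)) ls addn0.
  apply: leq_ltn_trans (_ : _ <= \sum_(1 <= j < l) 1)%N _.
    by apply: leq_sum => j _; case: (_ < _).
  by rewrite sum_nat_const_nat muln1; lia.
apply/negbTE; rewrite -ltnNge ltnS; apply: leq_trans (leq_addr _ _).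
rewrite (eq_big_nat _ _ (F2 := fun=> 1%N)) => [|j /andP[j0 jl]].
  by rewrite sum_nat_const_nat; lia.
by rewrite (lt_le_trans sl) // mono //; lia.
Qed.

Lemma step_path_bounds n tau s : (0 < n)%N ->
  1 <= step_path n tau s <= n%:Z.
Proof.
move=> n0; rewrite /step_path; apply/andP; split; first by lia.
have : (\sum_(1 <= j < n) (s < tau j)%R <= \sum_(1 <= j < n) 1)%N.
  by apply: leq_sum => j _; case: (_ < _).
by rewrite sum_nat_const_nat; lia.
Qed.

Lemma near_sum_indicator n (F : set_system R) {FF : Filter F}
    (a : nat -> R -> bool) (b : nat -> bool) :
  (forall j, \forall u \near F, a j u = b j) ->
  \forall u \near F, (\sum_(1 <= j < n) a j u = \sum_(1 <= j < n) b j)%N.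
Proof.
move=> ab; have H : \forall u \near F, forall j : 'I_n, a j u = b j.
  by apply: filter_forall => j; exact: ab.
apply: filterS H => u Hu; rewrite !big_nat; apply: eq_bigr => j /andP[_ jn].
by rewrite (Hu (Ordinal jn)).
Qed.

Lemma step_path_is_path n tau : (0 < n)%N ->
  (forall j, (j <= n)%N -> tau j <= tau 0%N) ->
  is_path (tau n, n%:Z) (tau 0%N, 1%:Z) (step_path n tau).
Proof.
move=> n0 tau0; split=> /=.
- move=> s t _ _ st; rewrite /step_path lez_nat ltnS; apply: leq_sum => j _.
  by case: ltP => // tt; case: ltP => //; lra.
- move=> s _.
  apply: filterS (near_sum_indicator n (F := s^'+) (a := fun j u => u < tau j)
    (b := fun j => s < tau j) _) => [u Hu|j]; first by rewrite /step_path Hu.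
  have [st|ts] := ltP s (tau j); first exact: nbhs_right_lt.
  near=> u; apply/negbTE; rewrite -leNgt (le_trans ts) //.
(* Just before [s], a jump at time [s] itself is still to come, whence the weak inequality in the
   left limit. *)
- move=> s _; exists (\sum_(1 <= j < n) (s <= tau j)%R).+1%:Z.
  apply: filterS (near_sum_indicator n (F := s^'-) (a := fun j u => u < tau j)
    (b := fun j => s <= tau j) _) => [u Hu|j]; first by rewrite /step_path Hu.
  have [st|ts] := leP s (tau j).
    by near=> u; apply: lt_le_trans st; near: u; exact: nbhs_left_lt.
  near=> u; apply/negbTE; rewrite -leNgt; near: u; exact: nbhs_left_ge.
- by have /andP[] := step_path_bounds tau (tau n) n0.
rewrite /step_path big_nat_cond big1 // => j /andP[/andP[_ jn] _].
by rewrite ltNge tau0 // ltnW.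
Unshelve. all: by end_near.
Qed.

End PathsOfArrays.

(** * Last passage values as suprema over interlacing arrays *)

Section PathArrays.
Context {R : realType}.

Lemma path_lengthE n (f : int -> R -> R) (x y : R) pi : (0 < n)%N ->
  path_length f (x, n%:Z) (y, 1%:Z) pi =
  \sum_(l < n) (f l.+1%:Z (jump_time (x, n%:Z) (y, 1%:Z) pi l%:Z) -
                f l.+1%:Z (jump_time (x, n%:Z) (y, 1%:Z) pi l.+1%:Z)).
Proof.
move=> n0; rewrite /path_length /=; have -> : `|n%:Z - 1%:Z|%N.+1 = n by lia.
apply: eq_bigr => l _; have -> : 1%:Z + l%:Z = l.+1%:Z by lia.
by have -> : l.+1%:Z - 1 = l%:Z by lia.
Qed.

Lemma jump_time_step_path n (tau : nat -> R) l : (0 < n)%N ->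
  (forall j j', (j <= j' <= n)%N -> tau j' <= tau j) -> (l <= n)%N ->
  jump_time (tau n, n%:Z) (tau 0%N, 1%:Z) (step_path n tau) l%:Z = tau l.
Proof.
move=> n0 mono ln.
have [->|nl] := eqVneq l n; first by rewrite /jump_time /= eqxx.
have [->|l0] := eqVneq l 0%N.
  by rewrite /jump_time /= ifF ?ifT //; lia.
have lP s : (step_path n tau s <= l%:Z) = (tau l <= s).
  by apply: step_path_le => //; lia.
apply: jump_time_eq => /=; [lia|lia|split].
- by rewrite !mono //; lia.
- by move=> s /andP[_]; rewrite ltNge -lP; lia.
- by move=> s /andP[]; rewrite -lP.
Qed.

(** Jump times turn disjoint paths into an array, and step paths turn an array into disjoint paths.
    Both passages preserve length, which suffices for the suprema to agree. *)
Lemma last_passage_arrays n k (x y : 'I_k -> R) (U V : 'I_k -> R * int) f :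
  (0 < n)%N -> (forall i, U i = (x i, n%:Z)) -> (forall i, V i = (y i, 1%:Z)) ->
  endpoint_pair U V ->
  last_passage f U V =
  ereal_sup [set (array_length n k f T)%:E | T in
    [set T | interlacing n k T /\
             forall i : 'I_k, T i n = x i /\ T i 0%N = y i]].
Proof.
move=> n0 hU hV [xy _ ord _]; congr ereal_sup.
have {}xy i : x i <= y i by have := xy i; rewrite hU hV.
have {}ord (i j : 'I_k) : j = i.+1 :> nat -> x i <= x j /\ y i <= y j.
  by move=> /ord; rewrite !hU !hV.
apply/seteqP; split=> z /= [].
  move=> pi [pip pid] <-.
  have {}pip i : is_path (x i, n%:Z) (y i, 1%:Z) (pi i).
    by have := pip i; rewrite hU hV.
  pose J (i : 'I_k) l := jump_time (x i, n%:Z) (y i, 1%:Z) (pi i) l%:Z.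
  (* Arrays have rows indexed by all naturals; rows from [k] on get the default [0]. *)
  pose T i l : R := if insub i is Some j then J j l else 0.
  have TJ (i : 'I_k) l : T i l = J i l by rewrite /T valK.
  have JP i l : (l <= n)%N -> x i <= J i l <= y i /\
      forall s, x i < s < y i -> (pi i s <= l%:Z) = (J i l <= s).
    by move=> ln; exact: jump_timeP.
  exists T; last first.
    congr (_%:E); apply: eq_bigr => i _; rewrite hU hV path_lengthE //.
    by apply: eq_bigr => l _; rewrite !TJ.
  split; last first.
    move=> i; rewrite !TJ /J /jump_time /= eqxx; split=> //.
    by rewrite ifF ?ifT //; lia.
  split=> i l ik ln.
    rewrite -[i]/(nat_of_ord (Ordinal ik)) !TJ leNgt; set i' := Ordinal ik.
    apply/negP => H; have [/andP[l1 l2] lP] := JP i' l (ltnW ln).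
    have [/andP[l1' l2'] lP'] := JP i' l.+1 ln.
    (* Were the jump times out of order, the path would at their midpoint be at most [l] and yet
       above [l.+1]. *)
    pose s := (J i' l + J i' l.+1) / 2.
    have sI : x i' < s < y i' by apply/andP; split; rewrite /s; lra.
    have := lP' s sI; have := lP s sI.
    have -> : J i' l <= s by rewrite /s; lra.
    have -> : (J i' l.+1 <= s) = false by apply/negbTE; rewrite -ltNge /s; lra.
    by lia.
  have ik' := ltnW ik.
  rewrite -[i.+1]/(nat_of_ord (Ordinal ik)) TJ.
  rewrite -[X in T X _]/(nat_of_ord (Ordinal ik')) TJ.
  set i' := Ordinal ik'; set j' := Ordinal ik.
  have [xx yy] := ord i' j' erefl.
  rewrite leNgt; apply/negP => H.
  have [/andP[l1 l2] lP] := JP i' l (ltnW ln).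
  have [/andP[l1' l2'] lP'] := JP j' l.+1 ln.
  (* The ordering of the endpoints puts this midpoint inside both open intervals. There path [i'] is
     above [l] and path [j'] is at most [l.+1], against disjointness. *)
  pose s := (J i' l + J j' l.+1) / 2.
  have sI : x i' < s < y i' by apply/andP; split; rewrite /s; lra.
  have sI' : x j' < s < y j' by apply/andP; split; rewrite /s; lra.
  have := lP' s sI'; have := lP s sI.
  have := pid i' j' erefl s; rewrite !hU !hV => /(_ sI sI').
  have -> : J j' l.+1 <= s by rewrite /s; lra.
  have -> : (J i' l <= s) = false by apply/negbTE; rewrite -ltNge /s; lra.
  by lia.
move=> T [Tint TE] <-.
have mono i : (i < k)%N -> forall j j', (j <= j' <= n)%N -> T i j' <= T i j.
  by move=> ik j j' /andP[jj' jn]; exact: interlacing_le Tint ik jj' jn.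
exists (fun i : 'I_k => step_path n (T i)); last first.
  congr (_%:E); apply: eq_bigr => i _; rewrite hU hV path_lengthE //.
  have [<- <-] := TE i.
  have Ti := mono i (ltn_ord i).
  by apply: eq_bigr => l _; rewrite !jump_time_step_path // ltnW.
split=> [i|i j ij t].
  rewrite hU hV; have [<- <-] := TE i; apply: step_path_is_path => // l ln.
  exact: mono.
rewrite !hU !hV /= => /andP[xt ty] /andP[xt' ty'].
have /andP[b1 b2] := step_path_bounds (T j) t n0.
have /andP[b1' b2'] := step_path_bounds (T i) t n0.
have ijk : (i.+1 < k)%N by rewrite -ij.
rewrite ltNge; apply/negP => H.
(* If path [j] is on line [l.+1] at time [t], interlacing gives [T i l <= T j l.+1 <= t], so path
   [i] is already on line [l] or below. The extreme columns are handled by [x j < t] when [l.+1 = n]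
   and by [t < y i] when [l = 0]. *)
case E : (step_path n (T j) t) b1 b2 => [[|l]|//] //= _ ln.
have {}ln : (l < n)%N by lia.
have jl : T j l.+1 <= t.
  have [lE|ln'] := eqVneq l.+1 n.
    by rewrite lE (TE j).1 ltW.
  rewrite -(step_path_le (n := n)) ?E //; first exact: mono.
  by lia.
have il : T i l <= t by apply: le_trans jl; rewrite ij; exact: Tint.2.
case: l ln jl il E => [|l] ln jl il E.
  by move: il; rewrite (TE i).2; lra.
move: il; rewrite -(step_path_le (n := n)); [lia|exact: mono|lia].
Qed.

End PathArrays.

(** * Invariance under one sorting step, then under the melon map *)

Lemma last_passage_sigma (R : realType) (n k : nat) (x y : 'I_k -> R)
    (U V : 'I_k -> R * int) (f : int -> R -> R) (m : nat) :
  (forall i, U i = (x i, n%:Z)) -> (forall i, V i = (y i, 1%:Z)) ->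
  endpoint_pair U V -> (forall i, 0 <= x i) -> (m.+1 < n)%N ->
  (forall i : int, 1 <= i <= n%:Z -> {within `[0, +oo[, continuous (f i)}) ->
  (forall i : int, 1 <= i <= n%:Z ->
    {within `[0, +oo[, continuous (sigma m.+1%:Z f i)}) /\
  last_passage (sigma m.+1%:Z f) U V = last_passage f U V.
Proof.
move=> hU hV hUV x0 mn cf.
have n0 : (0 < n)%N by apply: leq_trans mn.
have m1 : (1 <= m.+1%:Z <= n%:Z) by lia.
have m2 : (1 <= m.+2%:Z <= n%:Z) by lia.
have m2E : m.+1%:Z + 1 = m.+2%:Z by lia.
have s1 : sigma m.+1%:Z f m.+1%:Z = W1 (f m.+1%:Z) (f m.+2%:Z).
  by rewrite /sigma eqxx m2E.
have s2 : sigma m.+1%:Z f m.+2%:Z = W2 (f m.+1%:Z) (f m.+2%:Z).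
  by rewrite /sigma ifF ?m2E ?eqxx //; lia.
have s3 i : i != m.+1%:Z -> i != m.+2%:Z -> sigma m.+1%:Z f i = f i.
  by move=> /negPf i1 /negPf i2; rewrite /sigma i1 m2E i2.
have cs i : 1 <= i <= n%:Z ->
    {within `[0, +oo[, continuous (sigma m.+1%:Z f i)}.
  have [->|i1] := eqVneq i m.+1%:Z.
    by rewrite s1 => _; apply: within_continuous_W1; exact: cf.
  have [->|i2] := eqVneq i m.+2%:Z.
    by rewrite s2 => _; apply: within_continuous_W2; exact: cf.
  by rewrite s3 //; exact: cf.
split=> //; rewrite !(last_passage_arrays _ n0 hU hV hUV).
have best u v : (forall i, (i < k)%N -> 0 <= u i) ->
    (forall i, (i < k)%N -> slot_min u v i <= slot_max k u v i) ->
    best_column k (sigma m.+1%:Z f m.+1%:Z) (sigma m.+1%:Z f m.+2%:Z) u v =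
    best_column k (f m.+1%:Z) (f m.+2%:Z) u v.
  by move=> u0 uv; rewrite s1 s2 best_column_melon //; exact: cf.
have T0 (T : nat -> nat -> R) :
    (forall i : 'I_k, T i n = x i /\ T i 0%N = y i) ->
    forall i, (i < k)%N -> 0 <= T i n.
  by move=> TE i ik; have [-> _] := TE (Ordinal ik).
apply/eqP; rewrite eq_le; apply/andP; split;
  apply: ge_ereal_sup => _ [T [Tint TE] <-].
  have [|T' [Tint' En E0 le]] :=
      array_length_improve Tint mn (T0 T TE) cs cf _ best.
    by move=> i i1 i2; rewrite s3.
  apply: le_ereal_sup_tmp; exists (array_length n k f T')%:E.
    by exists T' => //; split=> // i; rewrite En E0.
  by rewrite lee_fin.
have [T' [Tint' En E0 le]] :=
    array_length_improve Tint mn (T0 T TE) cf cs s3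
      (fun u v u0 uv => esym (best u v u0 uv)).
apply: le_ereal_sup_tmp; exists (array_length n k (sigma m.+1%:Z f) T')%:E.
  by exists T' => //; split=> // i; rewrite En E0.
by rewrite lee_fin.
Qed.

Theorem proposition4p1 (R : realType) (n k : nat) (x y : 'I_k -> R)
    (U V : 'I_k -> R * int)
    (hU : forall i, U i = (x i, n%:Z)) (hV : forall i, V i = (y i, 1%:Z))
    (hUV : endpoint_pair U V) (hx : forall i, 0 <= x i)
    (f : int -> R -> R)
    (hf : forall i : int, 1 <= i <= n%:Z ->
            {within `[0, +oo[, continuous (f i)})
    (w : seq 'I_n) (hw : reverse_word w) :
  last_passage f U V = last_passage (melon w f) U V.
Proof.
case: hw => wn _ _.
(* The induction along the word also carries continuity, which the next sorting step requires of its
   input. *)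
suff [] : (forall i : int, 1 <= i <= n%:Z ->
    {within `[0, +oo[, continuous (melon w f i)}) /\
  last_passage (melon w f) U V = last_passage f U V by [].
elim: w wn => [//|m w IH] /= /andP[mn /IH[cw lw]].
have [cs ls] := last_passage_sigma hU hV hUV hx mn cw.
by split=> //; rewrite ls.
Qed.
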